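(* Let $\mathbf{A}=\langle A,\mathbf{m}\rangle$ be a median algebra with $|A|\geq 5$. Then $\mathbf{A}$ is conservative if and only if there is a total order $\leq$ on $A$ such that $\mathbf{m}=\mathbf{m}_\leq$. Consequently, if $\mathbf{A}$ is a conservative median algebra (of any cardinality) whose operation is not the median operation of a totally ordered set, then $\mathbf{A}$ is isomorphic to $\mathbf{2}\times\mathbf{2}$.
   Context: A median algebra is a set $A$ with a ternary operation $\mathbf{m}$ satisfying $\mathbf{m}(x,x,y)=x$; $\mathbf{m}(x,y,z)=\mathbf{m}(y,x,z)=\mathbf{m}(y,z,x)$; and $\mathbf{m}(\mathbf{m}(x,y,z),t,u)=\mathbf{m}(x,\mathbf{m}(y,t,u),\mathbf{m}(z,t,u))$. It is conservative if $\mathbf{m}(x,y,z)\in\{x,y,z\}$ for all $x,y,z\in A$. For a total order $\leq$ on $A$, the median operation of $\leq$ is $\mathbf{m}_\leq(x,y,z)=(x\wedge y)\vee(x\wedge z)\vee(z\wedge y)$, where $\wedge,\vee$ are minimum and maximum with respect to $\leq$. $\mathbf{2}=\langle\{0,1\},\mathbf{m}\rangle$ is the two-element median algebra, where $\mathbf{m}$ is the ternary majority operation; $\mathbf{2}\times\mathbf{2}$ is the direct product (the median algebra of the four-element Boolean algebra). *)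

(* Defs.v *)
From mathcomp Require Import all_boot.
From mathcomp Require Import boolp classical_sets functions cardinality.

Set Implicit Arguments.
Unset Strict Implicit.
Unset Printing Implicit Defensive.

Record is_median (A : Type) (m : A -> A -> A -> A) : Prop := IsMedian {
  median_maj : forall x y, m x x y = x;
  median_swap : forall x y z, m x y z = m y x z;
  median_rot : forall x y z, m y x z = m y z x;
  median_distr : forall x y z t u,
    m (m x y z) t u = m x (m y t u) (m z t u) }.

Record medianAlgebra := MedianAlgebra {
  carrier :> Type;
  med : carrier -> carrier -> carrier -> carrier;
  medP : is_median med }.

Definition conservative (A : medianAlgebra) : Prop :=
  forall x y z : A, [\/ med x y z = x, med x y z = y | med x y z = z].

(* Orders are Prop-valued, so that no decidability is imposed on them; min and
   max are then defined by classical case analysis. *)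
Record is_total_order (A : Type) (le : A -> A -> Prop) : Prop := IsTotalOrder {
  total_order_refl : forall x, le x x;
  total_order_anti : forall x y, le x y -> le y x -> x = y;
  total_order_trans : forall x y z, le x y -> le y z -> le x z;
  total_order_total : forall x y, le x y \/ le y x }.

Definition ord_min (A : Type) (le : A -> A -> Prop) (x y : A) : A :=
  if `[< le x y >] then x else y.

Definition ord_max (A : Type) (le : A -> A -> Prop) (x y : A) : A :=
  if `[< le x y >] then y else x.

Definition ord_med (A : Type) (le : A -> A -> Prop) (x y z : A) : A :=
  ord_max le (ord_max le (ord_min le x y) (ord_min le x z)) (ord_min le z y).

Definition is_order_median (A : medianAlgebra) : Prop :=
  exists le : A -> A -> Prop,
    is_total_order le /\ forall x y z : A, med x y z = ord_med le x y z.

(* Booleans are added as the naturals 0 and 1. *)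
Definition majority (x y z : bool) : bool := 1 < x + y + z.

Lemma majority_is_median : is_median majority.
Proof. by split; do ![case]. Qed.

Definition two : medianAlgebra := MedianAlgebra majority_is_median.

Definition prod_med (A B : medianAlgebra) (p q r : A * B) : A * B :=
  (med p.1 q.1 r.1, med p.2 q.2 r.2).

Lemma prod_med_is_median (A B : medianAlgebra) : is_median (@prod_med A B).
Proof.
case: (medP A) => a1 a2 a3 a4; case: (medP B) => b1 b2 b3 b4.
split; rewrite /prod_med /=.
- by move=> [x x'] y; rewrite a1 b1.
- by move=> x y z; rewrite a2 b2.
- by move=> x y z; rewrite a3 b3.
- by move=> x y z t u; rewrite a4 b4.
Qed.

Definition prod_median (A B : medianAlgebra) : medianAlgebra :=
  MedianAlgebra (@prod_med_is_median A B).

Definition isomorphic (A B : medianAlgebra) : Prop :=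
  exists f : A -> B, bijective f /\
    forall x y z : A, f (med x y z) = med (f x) (f y) (f z).

(* Main.v *)
Require Import Defs.
From mathcomp Require Import all_boot.
From mathcomp Require Import boolp classical_sets functions cardinality.

Set Implicit Arguments.
Unset Strict Implicit.
Unset Printing Implicit Defensive.

Local Open Scope classical_set_scope.
Local Open Scope card_scope.

(** A conservative median algebra is studied through its betweenness relation:
    [y] is between [x] and [z] when [med x y z = y].  Conservativity says that
    of any three points one is between the other two.

    The crucial question is whether betweenness propagates: from [b] between
    [a] and [c], and [c] between [b] and [d], with [b <> c], does it follow that
    [b] is between [a] and [d]?  In a conservative algebra the only obstruction
    is a square, a 4-cycle in which each vertex is between its two neighbours
    ([betw_trans_or_square]).

    If there is a square, every further point [e] would lie between both pairs
    of opposite vertices and yet on no side of the square; conservativity of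
    the median of [e] with two neighbours excludes this
    ([square_exhaustive]).  So the square is the whole algebra, and its vertices
    are the elements of 2 x 2 ([square_isomorphic]).

    If there is no square, betweenness is that of a line, and an order is
    recovered by looking at the line from a point sent to minus infinity along
    a ray.  Fix [a <> b].  The points [n] with [a] between [n] and [b] form a
    chain going away from [b]; from such an [n], the points on the same side of
    [n] as [b] are totally ordered by [n]-[x]-[y], and this order does not
    change when [n] recedes.  The union of these orders is total, and by
    uniqueness of medians its median operation is [med]
    ([squarefree_order_median]).

    Hence a conservative algebra that is not the median algebra of an order is
    2 x 2, which has only four elements; this gives both assertions, since order
    medians are clearly conservative. *)

(** * Betweenness in a median algebra *)

Section Betweenness.

Variable A : medianAlgebra.
Implicit Types a b c d e x y z n : A.

Lemma med_swap12 x y z : med x y z = med y x z.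
Proof. exact: median_swap (medP A) _ _ _. Qed.

Lemma med_swap23 x y z : med x y z = med x z y.
Proof. by rewrite (median_rot (medP A)) med_swap12 -(median_rot (medP A)). Qed.

Lemma med_swap13 x y z : med x y z = med z y x.
Proof. by rewrite med_swap12 med_swap23 med_swap12. Qed.

Lemma med_maj12 x y : med x x y = x.
Proof. exact: median_maj (medP A) _ _. Qed.

Lemma med_maj23 x y : med x y y = y.
Proof. by rewrite med_swap13 med_maj12. Qed.

Lemma med_maj13 x y : med x y x = x.
Proof. by rewrite med_swap23 med_maj12. Qed.

Definition betw x y z : Prop := med x y z = y.

Lemma betw_refl_l x y : betw x x y.
Proof. exact: med_maj12. Qed.

Lemma betw_refl_r x y : betw x y y.
Proof. exact: med_maj23. Qed.

Lemma betw_sym x y z : betw x y z -> betw z y x.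
Proof. by rewrite /betw med_swap13. Qed.

Lemma betw_med x y z : betw x y z ->
  (med x y z = y) * (med z y x = y) * (med y x z = y) * (med y z x = y) *
  (med x z y = y) * (med z x y = y).
Proof.
move=> xyz; have zyx := betw_sym xyz.
by rewrite ![med y _ _]med_swap12 ![med _ _ y]med_swap23 xyz zyx.
Qed.

(** A triple has a single median. *)
Lemma betw_anti x y z : betw x y z -> betw y x z -> x = y.
Proof. by rewrite /betw [med y x z]med_swap12 => -> ->. Qed.

Lemma betw_eq x y : betw x y x -> x = y.
Proof. by rewrite /betw med_swap23 med_maj12. Qed.

(** Together with [betw_right]: if [c] is on the segment from [a] to [d], the
    points on the segment from [a] to [c] come before [c] on the way to [d].
    Both are instances of distributivity, valid in every median algebra. *)
Lemma betw_left a b c d : betw a b c -> betw a c d -> betw a b d.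
Proof.
rewrite /betw => abc acd.
have bac : med b a c = b by rewrite med_swap12.
rewrite med_swap12 -{1}bac (median_distr (medP A)) med_maj12.
by rewrite (med_swap12 c a d) acd.
Qed.

Lemma betw_right a b c d : betw a b c -> betw a c d -> betw b c d.
Proof.
rewrite /betw => abc acd.
have bac : med b a c = b by rewrite med_swap12.
by rewrite -bac (median_distr (medP A)) med_maj12 acd med_maj23.
Qed.

(** * Squares *)

(** Two inequalities suffice to make the four vertices distinct. *)
Record square a b c d : Prop := Square {
  square_ab : a <> b;
  square_bc : b <> c;
  square_abc : betw a b c;
  square_bcd : betw b c d;
  square_cda : betw c d a;
  square_dab : betw d a b }.

Lemma square_ac a b c d : square a b c d -> a <> c.
Proof. by move=> S ac; case: S; rewrite ac => ab bc /betw_eq /esym. Qed.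

Lemma square_rot a b c d : square a b c d -> square b c d a.
Proof.
case=> ab bc abc bcd cda dab; split=> // cd; apply: ab.
by apply: (betw_anti abc); apply: betw_sym; rewrite {1}cd.
Qed.

Hypothesis consA : conservative A.

Lemma betw_conservative x y z :
  [\/ betw y x z, betw x y z | betw x z y].
Proof.
case: (consA x y z) => h; [apply: Or31|apply: Or32|apply: Or33] => //.
  by rewrite /betw med_swap12.
by rewrite /betw med_swap23.
Qed.

(** Whichever of [a], [b], [d] is between the others, and likewise for
    [a], [c], [d], the cyclic configuration is the only one that fails. *)
Lemma betw_trans_or_square a b c d :
  b <> c -> betw a b c -> betw b c d -> betw a b d \/ square a b c d.
Proof.
move=> bc abc bcd.
have [<-|ab] := pselect (a = b); first by left; exact: betw_refl_l.
case: (betw_conservative a b d) => [bad|abd|adb]; [|by left|].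
- case: (betw_conservative a c d) => [cad|acd|adc].
  + case: bc; apply: (@betw_anti b c d) => //.
    exact: betw_left (betw_sym abc) cad.
  + by left; apply: betw_left abc acd.
  + by right; split=> //; apply: betw_sym.
- case: bc; apply: (@betw_anti b c d) => //.
  exact: betw_sym (betw_right adb abc).
Qed.

(** A square cannot be prolonged beyond [a] away from [c]: for a new point
    [e], [a] would lie between [e] and each of [b], [d], and no median of [b], [d], [e] would then
    be possible. *)
Lemma square_no_prolongation a b c d e :
  square a b c d -> betw c a e -> e = a.
Proof.
move=> S cae; case: (S) => ab _ /betw_sym cba _ cda dab.
have da : d <> a := square_ab (square_rot (square_rot (square_rot S))).
have bae : betw b a e := betw_right cba cae.
have dae : betw d a e := betw_right cda cae.
case: (betw_conservative b d e) => [dbe|bde|bed].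
- case: ab; apply: (@betw_anti _ _ e) => //.
  exact: betw_right dab dbe.
- case: da; apply: (@betw_anti _ _ e) => //.
  exact: betw_right (betw_sym dab) bde.
- apply: (@betw_anti _ _ d); first exact: betw_sym.
  exact: betw_right bae bed.
Qed.

Lemma square_diagonal a b c d e : square a b c d -> betw a e c.
Proof.
move=> S; case: (betw_conservative a e c) => [eac|//|ace].
- rewrite (square_no_prolongation S (betw_sym eac)).
  exact: betw_refl_l.
- rewrite (square_no_prolongation (square_rot (square_rot S)) ace).
  exact: betw_refl_r.
Qed.

(** A point inside the side [a]-[b] would leave no choice for its median with
    the endpoints of the opposite side. *)
Lemma square_side a b c d e :
  square a b c d -> betw a e b -> e = a \/ e = b.
Proof.
move=> S aeb; case: (S) => ab bc abc bcd cda dab.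
have da : d <> a := square_ab (square_rot (square_rot (square_rot S))).
have cea : betw c e a := betw_sym (square_diagonal e S).
have deb : betw d e b.
  exact: betw_sym (square_diagonal e (square_rot S)).
have ebc : betw e b c := betw_right aeb abc.
have ead : betw e a d.
  exact: betw_right (betw_sym aeb) (betw_sym dab).
case: (betw_conservative c d e) => [dce|cde|ced].
- right; apply: (@betw_anti _ _ c) => //.
  exact: betw_sym (betw_right dce deb).
- left; apply: (@betw_anti _ _ d) => //; apply: betw_sym.
  exact: betw_right cde cea.
- case: da; apply: (@betw_anti _ _ e); first exact: betw_sym.
  exact: betw_sym (betw_right ced cda).
Qed.

(** The median of [a], [b], [e] is one of them; whenever it is a vertex, [e]
    lies on the next or on the previous side. *)
Lemma square_exhaustive a b c d e :
  square a b c d -> [\/ e = a, e = b, e = c | e = d].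
Proof.
move=> S; have S1 := square_rot S.
have S3 := square_rot (square_rot S1).
have aec : betw a e c := square_diagonal e S.
have bed : betw b e d := square_diagonal e S1.
case: (betw_conservative a b e) => [bae|abe|aeb].
- have [->|->] := square_side S3 (betw_sym (betw_right bae bed)).
  + exact: Or44.
  + exact: Or41.
- have [->|->] := square_side S1 (betw_right abe aec).
  + exact: Or42.
  + exact: Or43.
- have [->|->] := square_side S aeb.
  + exact: Or41.
  + exact: Or42.
Qed.

(** Opposite sides of the square are the two fibres of a coordinate. *)
Lemma square_isomorphic a b c d :
  square a b c d -> isomorphic A (prod_median two two).
Proof.
move=> S; case: (S) => ab bc abc bcd cda dab.
have ac := square_ac S.
have bd := square_ac (square_rot S).
have S2 := square_rot (square_rot S).
have cd := square_ab S2.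
have da := square_bc S2.
pose g (p : bool * bool) : A :=
  if p.1 then (if p.2 then c else d) else (if p.2 then b else a).
have g_inj : injective g.
  by move=> [[] []] [[] []] // /esym; rewrite /g /= => // /esym.
have g_surj x : exists p, g p = x.
  case: (square_exhaustive x S) => ->.
  - by exists (false, false).
  - by exists (false, true).
  - by exists (true, true).
  - by exists (true, false).
have g_med p q r : g (@prod_med two two p q r) = med (g p) (g q) (g r).
  by move: p q r => [[] []] [[] []] [[] []]; rewrite /g /=
    ?(med_maj12, med_maj23, med_maj13, betw_med abc, betw_med bcd, betw_med cda,
      betw_med dab).
pose f x : bool * bool := projT1 (cid (g_surj x)).
have fK : cancel f g by move=> x; rewrite /f; case: cid.
have gK : cancel g f by move=> p; apply: g_inj; rewrite fK.
exists f; split; first by exists g.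
by move=> x y z; apply: g_inj; rewrite fK g_med !fK.
Qed.

End Betweenness.

(** * Medians of total orders *)

Section OrderMedian.

Variables (T : Type) (le : T -> T -> Prop).
Hypothesis le_order : is_total_order le.
Implicit Types x y z : T.

Lemma ord_minl x y : le x y -> ord_min le x y = x.
Proof. by rewrite /ord_min; case: asboolP. Qed.

Lemma ord_minr x y : le y x -> ord_min le x y = y.
Proof.
rewrite /ord_min; case: asboolP => // xy yx.
exact: (total_order_anti le_order).
Qed.

Lemma ord_maxr x y : le x y -> Defs.ord_max le x y = y.
Proof. by rewrite /Defs.ord_max; case: asboolP. Qed.

Lemma ord_maxl x y : le y x -> Defs.ord_max le x y = x.
Proof.
rewrite /Defs.ord_max; case: asboolP => // xy yx.
exact: (total_order_anti le_order).
Qed.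

Lemma ord_med_mid x y z : le x y -> le y z ->
  (ord_med le x y z = y) * (ord_med le z y x = y) * (ord_med le y x z = y) *
  (ord_med le y z x = y) * (ord_med le x z y = y) * (ord_med le z x y = y).
Proof.
move=> xy yz; have xz := total_order_trans le_order xy yz.
have rxx := total_order_refl le_order.
by rewrite /ord_med !(ord_minl xy, ord_minr xy, ord_minl yz, ord_minr yz,
  ord_minl xz, ord_minr xz, ord_maxr xy, ord_maxl xy, ord_maxr yz,
  ord_maxl yz, ord_maxr (rxx _)).
Qed.

(** The six conclusions are the arrangements of a sorted triple, so that a
    symmetric operation can be treated on sorted triples only. *)
Lemma sort3 (P : T -> T -> T -> Prop) :
  (forall x y z, le x y -> le y z ->
     [/\ P x y z, P x z y, P y x z & [/\ P y z x, P z x y & P z y x]]) ->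
  forall x y z, P x y z.
Proof.
move=> sP x y z.
have [xy|yx] := total_order_total le_order x y;
have [yz|zy] := total_order_total le_order y z;
have [xz|zx] := total_order_total le_order x z.
- by case: (sP _ _ _ xy yz).
- by case: (sP _ _ _ xy yz).
- by case: (sP _ _ _ xz zy).
- by case: (sP _ _ _ zx xy) => _ _ _ [].
- by case: (sP _ _ _ yx xz).
- by case: (sP _ _ _ yz zx) => _ _ _ [].
- by case: (sP _ _ _ zy yx) => _ _ _ [].
- by case: (sP _ _ _ zy yx) => _ _ _ [].
Qed.

Lemma ord_med_conservative x y z :
  [\/ ord_med le x y z = x, ord_med le x y z = y | ord_med le x y z = z].
Proof.
move: x y z; apply: sort3 => x y z xy yz.
have E := ord_med_mid xy yz; rewrite !E.
by split; [| | |split];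
  do ?[exact: Or31 (erefl _) | exact: Or32 (erefl _) | exact: Or33 (erefl _)].
Qed.

End OrderMedian.

Lemma order_median_conservative (A : medianAlgebra) :
  is_order_median A -> conservative A.
Proof.
by move=> [le [le_order medE]] x y z; rewrite medE; apply: ord_med_conservative.
Qed.

(** Betweenness of sorted triples determines the median, because any three
    points can be sorted. *)
Lemma betw_order_median (A : medianAlgebra) (le : A -> A -> Prop) :
  is_total_order le ->
  (forall x y z : A, le x y -> le y z -> betw x y z) -> is_order_median A.
Proof.
move=> le_order le_betw; exists le; split=> //; apply: (sort3 le_order).
move=> x y z xy yz; have E := ord_med_mid le_order xy yz.
have F := betw_med (le_betw _ _ _ xy yz).
by rewrite !E !F.
Qed.

(** * Square-free algebras are linear *)

Section Squarefree.

Variable A : medianAlgebra.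
Implicit Types x y z t n m p : A.

Hypothesis consA : conservative A.
Hypothesis squarefree : forall a b c d : A, ~ square a b c d.

Lemma betw_trans (a b c d : A) :
  b <> c -> betw a b c -> betw b c d -> betw a b d.
Proof.
move=> bc abc bcd.
by case: (betw_trans_or_square consA bc abc bcd) => // /squarefree.
Qed.

Variables a b : A.
Hypothesis ab : a <> b.

(** Seen from [b], [m] is on the way to [n].  The [n] with [recede n a] form
    the ray that starts at [a] and leads away from [b]. *)
Definition recede (n m : A) : Prop := betw n m b.

(** For [n <> b], the closed half-line issuing from [n] towards [b]. *)
Definition beyond n x : Prop := betw n x b \/ betw n b x.

Lemma recede_neq n : recede n a -> n <> b.
Proof. by move=> na nb; apply: ab; apply/esym/betw_eq; rewrite -{1}nb. Qed.

Lemma recede_total n m :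
  recede n a -> recede m a -> recede n m \/ recede m n.
Proof.
move=> na ma; case: (betw_conservative consA n m b) => [mnb|nmb|nbm].
- by right.
- by left.
- case: ab; apply: (@betw_anti _ _ _ m) => //.
  + exact: betw_right na nbm.
  + exact: betw_sym.
Qed.

(** A point that is not beyond [a] is itself on the ray. *)
Lemma exists_beyond x : exists n, recede n a /\ beyond n x.
Proof.
case: (betw_conservative consA x a b) => [axb|xab|xba].
- by exists a; split; [exact: betw_refl_l|left].
- by exists x; split=> //; left; exact: betw_refl_l.
- by exists a; split; [exact: betw_refl_l|right; exact: betw_sym].
Qed.

Lemma beyond_recede n m x :
  m <> b -> recede n m -> beyond m x -> beyond n x.
Proof.
move=> mb nm [mxb|mbx]; [left|right].
  exact: betw_sym (betw_left (betw_sym mxb) (betw_sym nm)).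
exact: betw_sym (betw_trans (nesym mb) (betw_sym mbx) (betw_sym nm)).
Qed.

Lemma recede_betw n m x :
  m <> b -> recede n m -> beyond m x -> betw n m x.
Proof.
move=> mb nm [mxb|mbx].
  exact: betw_sym (betw_right (betw_sym mxb) (betw_sym nm)).
exact: betw_trans mb nm mbx.
Qed.

(** The only other possibility is [n] strictly between [x] and [y], and then
    one of the two would be on the side of [n] opposite to [b]. *)
Lemma beyond_total n x y :
  n <> b -> beyond n x -> beyond n y -> betw n x y \/ betw n y x.
Proof.
move=> nb nx ny.
have [->|neq_nx] := pselect (n = x); first by left; exact: betw_refl_l.
have [->|neq_ny] := pselect (n = y); first by right; exact: betw_refl_l.
case: nx ny => [nxb|nbx] [nyb|nby].
- case: (betw_conservative consA n x y) => [xny|nxy|nyx]; [|by left|by right].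
  case: neq_nx; apply: (betw_anti nxb).
  exact: betw_trans neq_ny xny nyb.
- by left; apply: betw_left nxb nby.
- by right; apply: betw_left nyb nbx.
- case: (betw_conservative consA n x y) => [xny|nxy|nyx]; [|by left|by right].
  case: nb; apply: (betw_anti nbx).
  exact: betw_right (betw_sym nby) (betw_sym xny).
Qed.

(** A single witness is enough, since orders seen from two points of the ray
    agree by [ray_le_recede]. *)
Definition ray_le x y : Prop :=
  exists n, [/\ recede n a, beyond n x, beyond n y & betw n x y].

(** This makes the orders seen from the various points of the ray compatible:
    the segment from [n] to [y] passes through [m], so it prolongs the segment
    from [m] to [y] without disturbing [x]. *)
Lemma ray_le_recede n m x y :
  recede m a -> recede n m -> beyond m y -> betw m x y -> betw n x y.
Proof.
move=> ma nm my mxy.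
have nmy := recede_betw (recede_neq ma) nm my.
exact: betw_sym (betw_left (betw_sym mxy) (betw_sym nmy)).
Qed.

Lemma recede_common n m :
  recede n a -> recede m a ->
  exists p, [/\ recede p a, recede p n & recede p m].
Proof.
move=> na ma; have [nm|mn] := recede_total na ma.
  by exists n; split=> //; exact: betw_refl_l.
by exists m; split=> //; exact: betw_refl_l.
Qed.

Lemma ray_le_common x y z t :
  ray_le x y -> ray_le z t -> exists n, betw n x y /\ betw n z t.
Proof.
move=> [n [na nx ny nxy]] [m [ma mz mt mzt]].
have [p [pa pn pm]] := recede_common na ma.
by exists p; split; [exact: ray_le_recede nxy|exact: ray_le_recede mzt].
Qed.

Lemma ray_le_betw x y z : ray_le x y -> ray_le y z -> betw x y z.
Proof.
move=> xy yz; have [n [nxy nyz]] := ray_le_common xy yz.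
exact: betw_right nxy nyz.
Qed.

Lemma ray_le_order : is_total_order ray_le.
Proof.
split.
- move=> x; have [n [na nx]] := exists_beyond x.
  by exists n; split=> //; exact: betw_refl_r.
- move=> x y xy yx; have [n [nxy nyx]] := ray_le_common xy yx.
  by apply: betw_anti (betw_sym nyx) (betw_sym nxy).
- move=> x y z [n [na nx ny nxy]] [m [ma my mz myz]].
  have [p [pa pn pm]] := recede_common na ma.
  exists p; split=> //.
  + exact: beyond_recede (recede_neq na) pn nx.
  + exact: beyond_recede (recede_neq ma) pm mz.
  + by apply: (@betw_left _ _ _ y);
      [exact: ray_le_recede nxy|exact: ray_le_recede myz].
- move=> x y; have [n [na nx]] := exists_beyond x.
  have [m [ma my]] := exists_beyond y.
  have [p [pa pn pm]] := recede_common na ma.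
  have px := beyond_recede (recede_neq na) pn nx.
  have py := beyond_recede (recede_neq ma) pm my.
  by have [pxy|pyx] := beyond_total (recede_neq pa) px py;
    [left|right]; exists p.
Qed.

End Squarefree.

Lemma squarefree_order_median (A : medianAlgebra) :
  conservative A -> (forall a b c d : A, ~ square a b c d) ->
  is_order_median A.
Proof.
move=> consA squarefree.
have [[a [b ab]]|A_subsingleton] := pselect (exists a b : A, a <> b).
  apply: (betw_order_median (ray_le_order consA squarefree ab)).
  exact: ray_le_betw.
have eqA (x y : A) : x = y.
  by apply: contrapT => xy; apply: A_subsingleton; exists x, y.
by exists (fun _ _ => True); split; [split=> //; left|].
Qed.

Lemma conservative_not_order_median (A : medianAlgebra) :
  conservative A -> ~ is_order_median A -> isomorphic A (prod_median two two).
Proof.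
move=> consA not_order.
have [a [b [c [d S]]]] : exists a b c d : A, square a b c d.
  apply: contrapT => squarefree; apply/not_order/squarefree_order_median => //.
  by move=> a b c d S; apply: squarefree; exists a, b, c, d.
by apply: square_isomorphic S.
Qed.

Lemma isomorphic_two_two_lt5 (A : medianAlgebra) :
  isomorphic A (prod_median two two) -> ~ ([set: 'I_5] #<= [set: A]).
Proof.
move=> [f [/bij_inj f_inj _]] I5A.
have AB : [set: A] #<= [set: bool * bool].
  by apply/pcard_injP; exists f => x y _ _ /f_inj.
have /pcard_injP[g g_inj] := card_le_trans I5A AB.
have /leq_card : injective g by move=> i j; apply: g_inj; rewrite inE.
by rewrite card_ord card_prod card_bool.
Qed.

Theorem theorem3 (A : medianAlgebra) :
  ([set: 'I_5] #<= [set: A] ->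
     (conservative A <-> is_order_median A))
  /\
  (conservative A -> ~ is_order_median A ->
     isomorphic A (prod_median two two)).
Proof.
split; last exact: conservative_not_order_median.
move=> I5A; split; last exact: order_median_conservative.
move=> consA; apply: contrapT => not_order.
apply: (@isomorphic_two_two_lt5 A) I5A.
exact: conservative_not_order_median.
Qed.
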